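(* For any distinct $a,b\in\mathbb{R}$, a pair $(\alpha,\beta)\in\mathbb{R}^2$ is $\{\pm1\}$-feasible if and only if it is $\{a,b\}$-feasible. Furthermore, data stored using a $\{\pm1\}$-protocol can be used to retrieve $\mathbf{w}\mathbf{x}^\intercal$ for any distinct $a,b\in\mathbb{R}$ and any $\mathbf{w}\in\{a,b\}^k$ by using at most one additional node; that is, for any $\{\pm1\}$-protocol with parameters $(k,n,\ell)$, after adding at most one server (storing a fixed linear combination of the entries of $\mathbf{x}$ that does not depend on $a,b$ or $\mathbf{w}$) to its encoding, $\mathbf{w}\mathbf{x}^\intercal$ can be computed for all distinct $a,b\in\mathbb{R}$, all $\mathbf{w}\in\{a,b\}^k$ and all $\mathbf{x}\in\mathbb{R}^k$ by accessing at most $\ell+1$ servers (whose identity is determined by $\mathbf{w}$).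
   Context: Protocols. Let $\mathcal{A}\subset\mathbb{R}$ be finite. An $\mathcal{A}$-protocol with parameters $(k,n,\ell)$ (positive integers, $n\ge k$) consists of a linear encoding $\mathbb{R}^k\to\mathbb{R}^n$, $\mathbf{x}\mapsto\mathbf{y}=(y_1,\dots,y_n)$ (each $y_i$ is a fixed linear combination of the entries of $\mathbf{x}$ and is stored on server, or node, $i$), together with, for every $\mathbf{w}\in\mathcal{A}^k$, a set $S_{\mathbf{w}}\subseteq[n]$ of at most $\ell$ servers (depending only on $\mathbf{w}$) and a decoding function that for every $\mathbf{x}\in\mathbb{R}^k$ computes $\mathbf{w}\mathbf{x}^\intercal$ from $(y_i)_{i\in S_{\mathbf{w}}}$. Feasibility. A pair $(\alpha,\beta)\in\mathbb{R}^2$ is $\mathcal{A}$-feasible if there is an infinite family of $\mathcal{A}$-protocols with parameters $\{(k_i,n_i,\ell_i)\}_{i\ge0}$, with $k_i$ strictly increasing, such that $\lim_{i\to\infty}(n_i/k_i,\ell_i/k_i)=(\alpha,\beta)$. *)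

(* Defs.v *)
From mathcomp Require Import all_boot all_order all_algebra finmap.
From mathcomp Require Import all_classical all_reals all_analysis.

Set Implicit Arguments.
Unset Strict Implicit.
Unset Printing Implicit Defensive.

Import Order.TTheory GRing.Theory Num.Theory.
Import numFieldNormedType.Exports.
Local Open Scope ring_scope.
Local Open Scope classical_set_scope.

(* A decoder may be an arbitrary, not necessarily linear, function, but its
   argument only carries the entries stored on the servers in [S]. *)
Definition decoder (R : realType) (n : nat) (S : {set 'I_n}) : Type :=
  ({i : 'I_n | i \in S} -> R) -> R.

(* [x *m G] is the encoded vector; its [i]-th entry is stored on server [i]. *)
Definition computes (R : realType) (k n : nat) (G : 'M[R]_(k, n))
    (w : 'rV[R]_k) (S : {set 'I_n}) (d : decoder R S) : Prop :=
  forall x : 'rV[R]_k,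
    d (fun i => (x *m G) ord0 (val i)) = (w *m x^T) ord0 ord0.

(* [servers] and [decode] are total in [w]; only their values at coefficient
   vectors [w] with all entries in [A] are constrained. *)
Record protocol (R : realType) (A : {fset R}) (k n l : nat) := Protocol {
  encoding : 'M[R]_(k, n);
  servers : 'rV[R]_k -> {set 'I_n};
  decode : forall w : 'rV[R]_k, decoder R (servers w);
  protocol_k_gt0 : (0 < k)%N;
  protocol_l_gt0 : (0 < l)%N;
  protocol_le_kn : (k <= n)%N;
  protocol_access : forall w : 'rV[R]_k,
    (forall j, w ord0 j \in A) -> (#|servers w| <= l)%N;
  protocol_correct : forall w : 'rV[R]_k,
    (forall j, w ord0 j \in A) -> computes encoding w (@decode w)
}.

Definition feasible (R : realType) (A : {fset R}) (alpha beta : R) : Prop :=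
  exists k n l : nat -> nat,
    [/\ forall i, inhabited (protocol A (k i) (n i) (l i)),
        forall i j, (i < j)%N -> (k i < k j)%N &
        (((n i)%:R / (k i)%:R : R), ((l i)%:R / (k i)%:R : R)) @[i --> \oo]
          --> (alpha, beta)].

(* Main.v *)
(* A vector [w] with at most two distinct entries is [p s + q 1], where [s] has
   all its entries in a given pair [{a, b}].  Hence one extra server storing the
   sum of the entries of [x] turns any [{a, b}]-protocol into a protocol for
   every other pair, with parameters [(k, n + 1, l + 1)]; as [k] tends to
   infinity along a feasible family, the limit is unaffected. *)

Require Import Defs.
From mathcomp Require Import all_boot all_order all_algebra finmap.
From mathcomp Require Import all_classical all_reals all_analysis.
From mathcomp Require Import ring.

Set Implicit Arguments.
Unset Strict Implicit.
Unset Printing Implicit Defensive.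

Import Order.TTheory GRing.Theory Num.Theory.
Import numFieldNormedType.Exports.
Local Open Scope ring_scope.

(* [w ord0 j0] itself when [w] is constant: the slope is then [0]. *)
Definition other_value (R : realType) (k : nat) (j0 : 'I_k) (w : 'rV[R]_k) : R :=
  w ord0 (odflt j0 [pick j | w ord0 j != w ord0 j0]).

(** The entry at [j0] is the reference: which entries become [a] is read off from [w] alone, without
    knowing the pair it takes its values in, so one choice of servers and decoders serves all
    pairs. *)
Definition pattern (R : realType) (a b : R) (k : nat) (j0 : 'I_k)
    (w : 'rV[R]_k) : 'rV[R]_k :=
  \row_j (if w ord0 j == w ord0 j0 then a else b).

Definition slope (R : realType) (a b : R) (k : nat) (j0 : 'I_k)
    (w : 'rV[R]_k) : R := (w ord0 j0 - other_value j0 w) / (a - b).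

Definition intercept (R : realType) (a b : R) (k : nat) (j0 : 'I_k)
    (w : 'rV[R]_k) : R := w ord0 j0 - slope a b j0 w * a.

Lemma pattern_in (R : realType) (a b : R) (k : nat) (j0 : 'I_k)
    (w : 'rV[R]_k) j : pattern a b j0 w ord0 j \in [fset a; b]%fset.
Proof. by rewrite mxE; case: ifP; rewrite !inE eqxx ?orbT. Qed.

(** The affine map with this slope and intercept sends [a] to the entry at [j0] and [b] to the other
    value of [w]. *)
Lemma pattern_decomposition (R : realType) (a b c d : R) (k : nat) (j0 : 'I_k)
    (w : 'rV[R]_k) :
  a <> b -> (forall j, w ord0 j \in [fset c; d]%fset) ->
  w = slope a b j0 w *: pattern a b j0 w + intercept a b j0 w *: const_mx 1.
Proof.
move=> /eqP neq_ab w_in; have ab0 : a - b != 0 by rewrite subr_eq0.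
apply/rowP => j; rewrite !mxE /intercept mulr1.
case: eqP => [->|/eqP neq_j]; first by rewrite addrC subrK.
suff -> : w ord0 j = other_value j0 w by rewrite /slope; field.
rewrite /other_value; case: pickP => [j1 /= neq_j1|/(_ j)]; last by rewrite neq_j.
(* Among two possible values, two entries that both differ from the one at [j0] coincide. *)
move: (w_in j0) (w_in j) (w_in j1) neq_j neq_j1; rewrite !inE.
by do 3![case/orP => /eqP ->]; rewrite ?eqxx.
Qed.

Lemma protocol_extension (R : realType) (a b : R) (k n l : nat)
    (P : protocol [fset a; b]%fset k n l) :
  a <> b ->
  exists (S : 'rV[R]_k -> {set 'I_(n + 1)})
         (dec : forall w : 'rV[R]_k, decoder R (S w)),
  forall (c d : R) (w : 'rV[R]_k), (forall j, w ord0 j \in [fset c; d]%fset) ->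
    (#|S w| <= l + 1)%N /\
    computes (row_mx (encoding P) (const_mx 1)) w (dec w).
Proof.
(* A reference index exists because [k] is positive. *)
move=> neq_ab; pose j0 := Ordinal (protocol_k_gt0 P).
pose old w := servers P (pattern a b j0 w).
pose S w : {set 'I_(n + 1)} := rshift n ord0 |: [set lshift 1 i | i in old w].
have oldS w (i : {i | i \in old w}) : lshift 1 (val i) \in S w.
  by rewrite finset.in_setU imset_f ?orbT //; exact: valP.
have newS w : rshift n ord0 \in S w by rewrite finset.in_setU1 eqxx.
(* With [w = p s + q 1], the old decoder for [s] supplies the product of [s] and [x], and the new
   server supplies the sum of the entries of [x]. *)
pose dec w : decoder R (S w) := fun y =>
  slope a b j0 w *
    Defs.decode (p := P) (fun i : {i | i \in old w} =>
      y (exist (fun i => i \in S w) _ (oldS w i)))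
  + intercept a b j0 w * y (exist (fun i => i \in S w) _ (newS w)).
exists S, dec => c d w w_in; split.
  rewrite [leqRHS]addnC (leq_trans (finset.leq_card_setU _ _)) // cards1 leq_add2l.
  rewrite card_imset; last exact: lshift_inj.
  exact/protocol_access/pattern_in.
move=> x; rewrite [in RHS](pattern_decomposition j0 neq_ab w_in).
rewrite mulmxDl -!scalemxAl [RHS]mxE [in X in _ = X + _]mxE [in X in _ = _ + X]mxE.
rewrite /dec; congr (_ * _ + _ * _).
  rewrite -(protocol_correct P (@pattern_in _ a b _ j0 w)).
  by congr (Defs.decode _); apply/funext => i; rewrite mul_mx_row row_mxEl.
rewrite mul_mx_row row_mxEr !mxE; apply: eq_bigr => j _.
by rewrite !mxE mulrC.
Qed.

Lemma protocol_transfer (R : realType) (a b c d : R) (k n l : nat) :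
  a <> b -> protocol [fset a; b]%fset k n l ->
  inhabited (protocol [fset c; d]%fset k (n + 1) (l + 1)).
Proof.
move=> neq_ab P; have [S [dec SdecP]] := protocol_extension P neq_ab.
constructor; apply: (@Protocol _ _ _ _ _ _ S dec).
- exact: (protocol_k_gt0 P).
- by rewrite addn1.
- by rewrite (leq_trans (protocol_le_kn P)) // leq_addr.
- by move=> w /SdecP[].
- by move=> w /SdecP[_]; exact.
Qed.

(** A strictly increasing sequence of naturals dominates the identity, hence tends to infinity. *)
Lemma cvg_inv_increasing (R : realType) (k : nat -> nat) :
  (forall i j, (i < j)%N -> (k i < k j)%N) ->
  (((k i)%:R^-1 : R) @[i --> \oo] --> (0 : R))%classic.
Proof.
move=> k_incr; have le_k i : (i <= k i)%N.
  by elim: i => // i /leq_ltn_trans; apply; exact: k_incr.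
have k_oo : (k @ \oo --> \oo)%classic.
  move=> A [N _ NA]; exists N => // i /= le_Ni; apply: NA => /=.
  exact: (leq_trans le_Ni (le_k i)).
apply/gtr0_cvgV0; last exact: (cvg_comp _ _ k_oo cvgr_idn).
near=> i; rewrite ltr0n (leq_trans _ (le_k i)) //.
by near: i; exact: nbhs_infty_gt.
Unshelve. all: by end_near. Qed.

Lemma feasible_transfer (R : realType) (a b c d alpha beta : R) :
  a <> b -> feasible [fset a; b]%fset alpha beta ->
  feasible [fset c; d]%fset alpha beta.
Proof.
move=> neq_ab [k [n [l [P k_incr lim]]]].
exists k, (fun i => n i + 1)%N, (fun i => l i + 1)%N; split => //.
  by move=> i; have [Pi] := P i; exact: (protocol_transfer c d neq_ab Pi).
have inv_k := cvg_inv_increasing (R := R) k_incr.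
have inv_k2 : ((((k i)%:R^-1, (k i)%:R^-1) : R * R) @[i --> \oo]
    --> ((0, 0) : R * R))%classic by exact: (cvg_pair inv_k inv_k).
(* Each new ratio is the old one plus [1 / k i], so the limit is a sum of limits of pairs. *)
rewrite -[alpha]addr0 -[beta]addr0.
under eq_fun do rewrite !natrD !mulrDl !mul1r.
exact: (cvgD lim inv_k2).
Qed.

Theorem proposition1 (R : realType) :
  (forall a b : R, a <> b -> forall alpha beta : R,
     feasible [fset 1; -1]%fset alpha beta <->
     feasible [fset a; b]%fset alpha beta) /\
  (forall (k n l : nat) (P : protocol ([fset 1; -1]%fset : {fset R}) k n l),
     exists (e : nat) (H : 'M[R]_(k, e)),
       (e <= 1)%N /\
       exists (S : 'rV[R]_k -> {set 'I_(n + e)})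
              (d : forall w : 'rV[R]_k, decoder R (S w)),
         forall a b : R, a <> b ->
         forall w : 'rV[R]_k, (forall j, w ord0 j \in [fset a; b]%fset) ->
           (#|S w| <= l + 1)%N /\
           computes (row_mx (encoding P) H) w (d w)).
Proof.
have neq_1N1 : (1 : R) <> -1 by move=> e; have := ltrN10 R; rewrite -e ltr10.
split=> [a b neq_ab alpha beta|k n l P].
  (* The source pair is [1, -1] in one direction and [a, b] in the other; both are distinct. *)
  by split; exact: feasible_transfer.
have [S [dec SdecP]] := protocol_extension P neq_1N1.
exists 1%N, (const_mx 1); split => //; exists S, dec => a b _ w.
exact: SdecP.
Qed.
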